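(* Let $n\ge 3$ and $k\in\{2,3,\ldots,n-1\}$, and let $C_n$ be the cycle on $n$ vertices. Then ${\rm sgp}_k(C_n)=k$ if $\lfloor 2n/3\rfloor\le k\le n-2$, and ${\rm sgp}_k(C_n)=k+1$ otherwise.
   Context: For a nonempty $W\subseteq V(G)$ of a graph $G$, the Steiner distance $d_G(W)$ is the minimum number of edges of a connected subgraph of $G$ containing $W$; such a minimum subgraph is a tree, called a Steiner $W$-tree. For a positive integer $k$, a set $A\subseteq V(G)$ is a $k$-Steiner general position set if for every $B\subseteq A$ with $|B|=k$ and every Steiner $B$-tree $T_B$ we have $V(T_B)\cap A=B$. ${\rm sgp}_k(G)$ is the largest cardinality of a $k$-Steiner general position set of $G$. *)

(* Defs.v *)
From mathcomp Require Import all_boot.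

Set Implicit Arguments.
Unset Strict Implicit.
Unset Printing Implicit Defensive.

Record sgraph := SGraph {
  vertex :> finType;
  adj : rel vertex;
  adj_sym : symmetric adj;
  adj_irrefl : irreflexive adj
}.

Section Steiner.

Variable G : sgraph.
Implicit Types (W A B : {set G}) (H : {set G} * {set {set G}}).

Definition edges : {set {set G}} :=
  [set [set p.1; p.2] | p : G * G & adj p.1 p.2].

(* A pair H stands for the subgraph with vertex set H.1 and edge set H.2; it  *)
(* need not be induced, but every edge must have both ends in H.1.            *)
Definition subgraph H : bool :=
  (H.2 \subset edges) && [forall f in H.2, f \subset H.1].

Definition connected_subgraph H : bool :=
  [&& subgraph H, H.1 != set0 &
      [forall x in H.1, forall y in H.1,
         connect [rel u v | [set u; v] \in H.2] x y]].

Definition connects W H : bool := connected_subgraph H && (W \subset H.1).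

(* The seed #|edges| bounds #|H.2| for every subgraph H, so it does not       *)
(* affect the minimum as soon as some connected subgraph contains W.          *)
Definition steiner_dist W : nat :=
  \big[minn/#|edges|]_(H : {set G} * {set {set G}} | connects W H) #|H.2|.

Definition steiner_tree W H : bool :=
  connects W H && (#|H.2| == steiner_dist W).

Lemma steiner_treeP W H :
  reflect (connects W H /\ forall H', connects W H' -> #|H.2| <= #|H'.2|)
          (steiner_tree W H).
Proof.
have le_dist H' : connects W H' -> steiner_dist W <= #|H'.2|.
  rewrite /steiner_dist => cH'; have := mem_index_enum H'.
  elim: (index_enum _) => // H1 s IHs; rewrite inE big_cons => /orP[/eqP <-|/IHs le].
    by rewrite cH' geq_minl.
  by case: ifP => // _; rewrite (leq_trans (geq_minr _ _)).
apply: (iffP andP) => -[cH]; first by move=> /eqP ->; split.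
move=> minH; split=> //; rewrite eqn_leq le_dist // andbT /steiner_dist.
apply: (big_ind (fun d => #|H.2| <= d)) => //.
- by rewrite subset_leq_card //; case/and3P: (andP cH).1 => /andP[].
- by move=> a b lea leb; rewrite leq_min lea.
Qed.

Definition sgp_set k A : bool :=
  [forall B : {set G}, (B \subset A) && (#|B| == k) ==>
     [forall T : {set G} * {set {set G}},
        steiner_tree B T ==> (T.1 :&: A == B)]].

Definition sgp k : nat := \max_(A : {set G} | sgp_set k A) #|A|.

End Steiner.

Section Cycle.

Variable n : nat.

(* The conjunct i != j only matters for n = 1.                                *)
Definition cycle_adj : rel 'I_n :=
  [rel i j : 'I_n | (i != j) && ((j == i.+1 %% n :> nat) || (i == j.+1 %% n :> nat))].

Lemma cycle_adj_sym : symmetric cycle_adj.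
Proof. by move=> i j; rewrite /cycle_adj /= eq_sym orbC. Qed.

Lemma cycle_adj_irrefl : irreflexive cycle_adj.
Proof. by move=> i; rewrite /cycle_adj /= eqxx. Qed.

Definition cycle_graph : sgraph := SGraph cycle_adj_sym cycle_adj_irrefl.

End Cycle.

(* Main.v *)
Require Import Defs.
From mathcomp Require Import all_boot.
From mathcomp Require Import zify.

(** A set [A] of [k + 1] vertices of the cycle is in general position exactly when any two
    consecutive gaps of [A] are together longer than every other gap: a Steiner tree of [A]
    minus a vertex is the cycle with one longest gap cut out. Two consecutive gaps of length 1
    are forced when [3 (k + 1) > 2 n], and if [k + 1 < n] some other gap is then at least 2,
    whereas the evenly spread set [{floor (t n / (k + 1))}] has the required gaps when [3 (k +
    1) <= 2 n] or [k + 1 = n]. With [k + 2] or more vertices one can pick [B] missing two points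
    of [A] that separate two points of [B]. *)

Set Implicit Arguments.
Unset Strict Implicit.
Unset Printing Implicit Defensive.

(** * Finite sets and general facts on Steiner general position *)

Lemma subset_of_card (T : finType) (D : {set T}) k :
  k <= #|D| -> exists2 S : {set T}, S \subset D & #|S| = k.
Proof.
move=> le_kD; exists [set x in take k (enum D)].
  by apply/subsetP => x; rewrite inE => /mem_take; rewrite mem_enum.
rewrite cardsE (card_uniqP _) ?take_uniq ?enum_uniq // size_take -cardE.
by case: ltnP => // le_Dk; apply/eqP; rewrite eqn_leq le_kD le_Dk.
Qed.

Lemma card_setD1 (T : finType) (A : {set T}) x : x \in A -> #|A| = #|A :\ x|.+1.
Proof. by move=> Ax; rewrite (cardsD1 x) Ax. Qed.

Lemma card_ord_interval n lo hi : #|[set i : 'I_n | lo <= i < hi]| <= hi - lo.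
Proof.
rewrite cardE -(size_map val) -(size_iota lo (hi - lo)).
apply: uniq_leq_size => [|x]; first by rewrite (map_inj_uniq val_inj) enum_uniq.
by case/mapP => i; rewrite mem_enum inE mem_iota => Pi ->; move: Pi; rewrite /=; lia.
Qed.

(** The only admissible [B] is [A] itself. *)
Lemma sgp_set_card (G : sgraph) k (A : {set G}) : #|A| = k -> sgp_set k A.
Proof.
move=> cardA; apply/forallP => B; apply/implyP => /andP[sBA /eqP cardB].
have -> : B = A by apply/eqP; rewrite eqEcard sBA cardB cardA /=.
apply/forallP => T; apply/implyP => /andP[/andP[_ sAT] _].
by rewrite (setIidPr sAT).
Qed.

Lemma leq_sgp (G : sgraph) k (A : {set G}) : sgp_set k A -> #|A| <= sgp G k.
Proof. by move=> sA; apply: (@leq_bigmax_cond _ (fun A => sgp_set k A) (fun A => #|A|)). Qed.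

Lemma sgp_setE (G : sgraph) k (A B : {set G}) T :
  sgp_set k A -> B \subset A -> #|B| = k -> steiner_tree B T -> T.1 :&: A = B.
Proof.
move=> /forallP/(_ B)/implyP sA sBA cardB sT.
by have /forallP/(_ T)/implyP/(_ sT)/eqP := sA (introT andP (conj sBA (introT eqP cardB))).
Qed.

(** * Edges, cuts and arcs of the cycle *)

Section CycleSteiner.

Variable m : nat.
Local Notation n := m.+3.
Local Notation Cn := (cycle_graph n).
Implicit Types (A B W : {set Cn}) (H : {set Cn} * {set {set Cn}}).

Lemma max_vertex A :
  0 < #|A| -> exists2 x, x \in A & forall y, y \in A :\ x -> y < x.
Proof.
case/card_gt0P => x0 Ax0; case: (arg_maxnP (fun i : Cn => i : nat) Ax0) => x Ax maxx.
exists x => // y /setD1P[neq_yx Ay]; rewrite ltn_neqAle [y <= x]maxx // andbT.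
exact: neq_yx.
Qed.

(** Indices are reduced modulo [n], so that arcs may run past the vertex 0. *)
Definition vtx x : Cn := Ordinal (ltn_pmod x (ltn0Sn m.+2)).

Lemma vtx_ord (i : Cn) : vtx i = i.
Proof. by apply/val_inj/modn_small/ltn_ord. Qed.

Definition edge x : {set Cn} := [set vtx x; vtx x.+1].

Lemma val_vtxS (i : Cn) : vtx i.+1 = (if i.+1 == n then 0 else i.+1) :> nat.
Proof.
have := ltn_ord i; rewrite leq_eqVlt /=; case: eqP => [->|_] /=; first by rewrite modnn.
exact: modn_small.
Qed.

Lemma vtxS x : vtx x.+1 = vtx (vtx x).+1.
Proof. by apply/val_inj; rewrite /= -[in RHS]addn1 modnDml addn1. Qed.

Lemma adj_vtx x : adj (vtx x) (vtx x.+1).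
Proof.
apply/andP; split; last by rewrite vtxS /= eqxx.
apply/eqP => /(congr1 val)/=; rewrite -[RHS]/(nat_of_ord (vtx x.+1)) vtxS val_vtxS.
by case: ifP => [/eqP E E0|_]; [move: E; rewrite /= E0 | rewrite /=; lia].
Qed.

(** This rests on [n >= 3]: in a cycle of length 2 both edges would be the same pair. *)
Lemma edge_inj : injective (fun i : Cn => edge i).
Proof.
move=> i j /= Eij; apply/val_inj.
have := set21 (vtx i) (vtx i.+1); have := set22 (vtx i) (vtx i.+1).
have eqE (u v : Cn) : (u == v) = (u == v :> nat) by [].
rewrite -/(edge i) Eij !inE !eqE !vtx_ord !val_vtxS /=.
by have [?|?] := i.+1 =P n; have [?|?] := j.+1 =P n; lia.
Qed.

Lemma edge_in_edges x : edge x \in edges Cn.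
Proof. by apply/imsetP; exists (vtx x, vtx x.+1); rewrite ?inE ?adj_vtx. Qed.

Lemma edgesP (u v : Cn) : [set u; v] \in edges Cn ->
  (v = vtx u.+1) \/ (u = vtx v.+1).
Proof.
case/imsetP => -[p q]; rewrite inE /= => /andP[neq_pq adj_pq] Euv.
have Hu := set21 u v; have Hv := set22 u v.
have Hp := set21 p q; have Hq := set22 p q.
have {}adj_pq : q = vtx p.+1 \/ p = vtx q.+1.
  by case/orP: adj_pq => /eqP E; [left | right]; apply/val_inj.
move: Hu Hv Hp Hq; rewrite -Euv {1 2}Euv !inE.
case/orP => /eqP Eu; case/orP => /eqP Ev.
- by subst u v; rewrite eqxx orbb [q == p]eq_sym (negPf neq_pq).
- by subst u v.
- by subst u v; case: adj_pq; [right | left].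
- by subst u v; rewrite orbb (negPf neq_pq).
Qed.

(* Deleting the edges [edge i] and [edge j] leaves the arc i+1, ..., j and its complement. *)
Lemma missing_edges H (i j x y : Cn) :
    connected_subgraph H -> i < j -> edge i \notin H.2 -> edge j \notin H.2 ->
  x \in H.1 -> y \in H.1 -> (i < x <= j) = (i < y <= j).
Proof.
case/and3P => /andP[sHE _] _ /forall_inP conn ltij nHi nHj Hx Hy.
(* Only [edge i] and [edge j] cross the boundary of the arc, so its indicator is constant along the
   edges of [H]. *)
have step (u : Cn) : edge u \in H.2 -> (i < u <= j) = (i < vtx u.+1 <= j).
  move=> Hu; have neq w : edge w \notin H.2 -> u != w :> nat.
    by apply: contraNneq => <-.
  move: (neq i nHi) (neq j nHj) (ltn_ord j) (ltn_ord u); rewrite val_vtxS.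
  by have [?|?] := u.+1 =P n; lia.
pose a := [pred z : Cn | i < z <= j].
have clo : closed [rel u v : Cn | [set u; v] \in H.2] a.
  move=> u v /= Huv; rewrite !inE.
  case: (edgesP (subsetP sHE _ Huv)) => E.
    by rewrite E; apply: step; rewrite /edge -E vtx_ord.
  by rewrite E; apply/esym/step; rewrite /edge -E vtx_ord setUC.
by have /forall_inP/(_ _ Hy)/(closed_connect clo) := conn _ Hx; rewrite !inE.
Qed.

Definition arc s l : {set Cn} * {set {set Cn}} :=
  ([set vtx (s + t) | t : 'I_l.+1], [set edge (s + t) | t : 'I_l]).

Lemma mem_arc s l t : t <= l -> vtx (s + t) \in (arc s l).1.
Proof. by rewrite -ltnS => lt; apply/imsetP; exists (Ordinal lt). Qed.

Lemma card_arc_edges s l : #|(arc s l).2| <= l.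
Proof. by rewrite (leq_trans (leq_imset_card _ _)) ?card_ord. Qed.

Lemma connected_arc s l : connected_subgraph (arc s l).
Proof.
apply/and3P; split.
- apply/andP; split.
    by apply/subsetP => _ /imsetP[t _ ->]; apply: edge_in_edges.
  apply/forall_inP => _ /imsetP[t _ ->]; apply/subsetP => x.
  by rewrite !inE -addnS => /orP[] /eqP->; apply: mem_arc; have := ltn_ord t; lia.
- by apply/set0Pn; exists (vtx (s + 0)); apply: mem_arc.
have connS : connect_sym [rel u v | [set u; v] \in (arc s l).2].
  by apply: sym_connect_sym => u v /=; rewrite setUC.
have conn0 t : t <= l -> connect [rel u v | [set u; v] \in (arc s l).2] (vtx s) (vtx (s + t)).
  elim: t => [|t IHt] lt; first by rewrite addn0.
  apply: connect_trans (IHt (ltnW lt)) (connect1 _).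
  by rewrite addnS; apply/imsetP; exists (Ordinal lt).
apply/forall_inP => _ /imsetP[t _ ->]; apply/forall_inP => _ /imsetP[u _ ->].
have := (conn0 _ (ltn_ord t), conn0 _ (ltn_ord u)); rewrite connS => -[].
exact: connect_trans.
Qed.

(** * Steiner trees of the cycle and the bound [k + 1] *)

Lemma steiner_tree_exists W : exists T, steiner_tree W T.
Proof.
have W0 : connects W (arc 0 m.+2).
  rewrite /connects connected_arc; apply/subsetP => x _.
  by rewrite -[x]vtx_ord -(add0n x) mem_arc // -ltnS.
case: (arg_minnP (fun H => #|H.2|) W0) => T WT minT.
by exists T; apply/steiner_treeP.
Qed.

(** Otherwise let [a < b < c < d] be the four largest elements of [A], and let [B] consist of [a],
    [c] and [k - 2] smaller elements. A Steiner tree of [B] avoids [b] and [d], hence misses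
    [edge b] and [edge d], which separates [c] from [a]. *)
Lemma card_sgp_set_le k A : 1 < k -> sgp_set k A -> #|A| <= k.+1.
Proof.
move=> k_gt1 sA; rewrite leqNgt; apply/negP => cardA.
have [|d Ad maxd] := @max_vertex A; first by lia.
have cardD1 := card_setD1 Ad.
have [|c Ac maxc] := @max_vertex (A :\ d); first by lia.
have cardD2 := card_setD1 Ac.
have [|b Ab maxb] := @max_vertex (A :\ d :\ c); first by lia.
have cardD3 := card_setD1 Ab.
have [|a Aa maxa] := @max_vertex (A :\ d :\ c :\ b); first by lia.
have cardD4 := card_setD1 Aa.
have [|S sSD cardS] := @subset_of_card Cn (A :\ d :\ c :\ b :\ a) (k - 2); first by lia.
have ltab := maxb _ Aa; have ltbc := maxc _ Ab; have ltcd := maxd _ Ac.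
have nS x : x \in A :\ d :\ c :\ b :\ a = false -> x \notin S.
  by move=> nx; apply: contraFN nx; apply: (subsetP sSD).
have Sa : a \notin S by apply: nS; rewrite !inE eqxx.
have Sb : b \notin S by apply: nS; rewrite !inE eqxx andbF.
have Sc : c \notin S by apply: nS; rewrite !inE eqxx !andbF.
have Sd : d \notin S by apply: nS; rewrite !inE eqxx !andbF.
have neq (x y : Cn) : x < y -> ((x == y) = false) * ((y == x) = false).
  by move=> ltxy; split; apply/eqP => E; rewrite E ltnn in ltxy.
have [T sT] := steiner_tree_exists (a |: (c |: S)).
have cardB : #|a |: (c |: S)| = k.
  by rewrite !cardsU1 Sc !inE (negPf Sa) (neq a c (ltn_trans ltab ltbc)) cardS; exact: (subnKC k_gt1).
have sBA : a |: (c |: S) \subset A.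
  apply/subsetP => x; rewrite !inE => /or3P[/eqP->|/eqP->|/(subsetP sSD)].
  - by move: Aa; rewrite !inE => /and4P[].
  - by move: Ac; rewrite !inE => /andP[].
  - by rewrite !inE => /and5P[].
have TA := sgp_setE sA sBA cardB sT.
have /andP[/andP[connT sBT] _] := sT.
have nT x : x \in A -> x \notin a |: (c |: S) -> edge x \notin T.2.
  move=> Ax; rewrite -TA inE Ax andbT; apply: contra => Tx.
  have /and3P[/andP[_ /forall_inP/(_ _ Tx)/subsetP sT1] _ _] := connT.
  by apply: sT1; rewrite -{1}[x]vtx_ord set21.
have Tb : edge b \notin T.2.
  apply: nT; first by move: Ab; rewrite !inE => /and3P[].
  by rewrite !inE (negPf Sb) (neq a b ltab) (neq b c ltbc).
have Td : edge d \notin T.2.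
  apply: nT => //.
  rewrite !inE (negPf Sd) (neq c d ltcd) (neq a d) //.
  exact: ltn_trans ltab (ltn_trans ltbc ltcd).
have := missing_edges connT (ltn_trans ltbc ltcd) Tb Td
  (subsetP sBT a _) (subsetP sBT c _).
rewrite !inE !eqxx orbT => /(_ isT isT).
by rewrite ltbc (ltnW ltcd) ltnNge (ltnW ltab).
Qed.

(** * Dense sets: three consecutive vertices *)

Lemma card_cycle : #|Cn| = n.
Proof. exact: card_ord. Qed.

Lemma leq_card_edges (F : {set {set Cn}}) (M : {set Cn}) :
  (forall x : Cn, x \notin M -> edge x \in F) -> n <= #|M| + #|F|.
Proof.
move=> FM; have := @cardsC Cn M; rewrite card_cycle => {1}<-; rewrite leq_add2l -(card_imset _ edge_inj).
by apply/subset_leq_card/subsetP => _ /imsetP[x + ->]; rewrite inE => /FM.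
Qed.

Lemma vertex_in_edge H x : connected_subgraph H -> edge x \in H.2 ->
  (vtx x \in H.1) && (vtx x.+1 \in H.1).
Proof.
by case/and3P => /andP[_ /forall_inP sH] _ _ /sH; rewrite subUset !sub1set.
Qed.

(** Pulling [A] back along one and two steps of rotation keeps its size, and three subsets of an
    [n]-set with sizes adding up to more than [2 * n] have a common point. *)
Lemma consecutive_triple A : 2 * n < 3 * #|A| ->
  exists i : Cn, [/\ i \in A, vtx i.+1 \in A & vtx (vtx i.+1).+1 \in A].
Proof.
pose shift (i : Cn) := vtx i.+1.
have shift_inj : injective shift.
  move=> i j /(congr1 (fun x : Cn => nat_of_ord x)); rewrite !val_vtxS => E.
  apply/val_inj; move: E (ltn_ord i) (ltn_ord j) => /=.
  by have [?|?] := i.+1 =P n; have [?|?] := j.+1 =P n; lia.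
have cardV D := card_preimset (D : {set Cn}) shift_inj.
have le_n (D : {set Cn}) : #|D| <= n by apply: leq_trans (max_card _) (eq_leq card_cycle).
pose A1 := shift @^-1: A; pose A2 := shift @^-1: A1.
move=> ltA; have : 0 < #|A :&: A1 :&: A2|.
  have := (@cardsUI Cn A A1, @cardsUI Cn (A :&: A1) A2).
  have := (le_n (A :|: A1), le_n (A :&: A1 :|: A2)).
  rewrite !cardV; case=> U1 U2 [I1 I2].
  by move: ltA U1 U2 I1 I2; set x1 := #|A :&: A1| ; lia.
case/card_gt0P => i; rewrite !inE => /andP[/andP[Ai A1i] A2i].
by exists i.
Qed.

(** Here [m.+1] is [n - 2]: both edges at [c] are cut out. *)
Lemma mem_arcC1 (c x : Cn) : x != c -> x \in (arc c.+1 m.+1).1.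
Proof.
move=> neq_xc; have {neq_xc} : x <> c :> nat by move/val_inj/eqP; apply/negP.
have [[ltx ltc] neq] := (ltn_ord x, ltn_ord c).
have [lt_cx|le_xc] := ltnP c x.
  have -> : x = vtx (c.+1 + (x - c.+1)) by rewrite subnKC // vtx_ord.
  by apply: mem_arc; lia.
have -> : x = vtx (c.+1 + (x + n - c.+1)).
  by apply/val_inj; rewrite /= subnKC ?modnDr ?modn_small //; lia.
by apply: mem_arc; lia.
Qed.

(* Dropping the middle one of three consecutive vertices of [A] leaves a gap of length 2, which  *)
(* cannot be the unique longest one since another vertex is missing from [A].                   *)
Lemma card_sgp_set_dense k A :
  1 < k -> 2 * n < 3 * k.+1 -> k.+1 < n -> sgp_set k A -> #|A| <= k.
Proof.
move=> k_gt1 dense lt_kn sA; rewrite leqNgt; apply/negP => ltkA.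
have cardA : #|A| = k.+1 by apply/eqP; rewrite eqn_leq ltkA card_sgp_set_le.
have [|i []] := @consecutive_triple A; first by rewrite cardA.
have [j Dj] : exists j, j = vtx i.+1 by exists (vtx i.+1).
have [l Dl] : exists l, l = vtx j.+1 by exists (vtx j.+1).
rewrite -Dj -Dl => Ai Aj Al.
have [c nAc] : exists c, c \notin A.
  apply/existsP; rewrite -negb_forall; apply: contraL lt_kn => /forallP all_A.
  have /setP/esym E : A =i setT by move=> x; rewrite inE all_A.
  by rewrite -cardA -E cardsT card_cycle ltnn.
have [ltin ltjn] := (ltn_ord i, ltn_ord j).
have succP (x : Cn) : vtx x.+1 = x.+1 :> nat \/ x.+1 = n /\ vtx x.+1 = 0 :> nat.
  by rewrite val_vtxS; have [E|_] := x.+1 =P n; [right | left].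
have := (succP i, succP j); rewrite -Dj -Dl => -[Ej El].
have neq_ij : i != j by apply/eqP => /(congr1 (fun x : Cn => nat_of_ord x)) /=; lia.
have neq_lj : l != j by apply/eqP => /(congr1 (fun x : Cn => nat_of_ord x)) /=; lia.
have cardB : #|A :\ j| = k by apply/eqP; rewrite -eqSS -card_setD1 ?cardA.
have [T sT] := steiner_tree_exists (A :\ j).
have TA := sgp_setE sA (subD1set A j) cardB sT.
have /steiner_treeP[/andP[connT sBT] minT] := sT.
have nTj : j \notin T.1.
  by apply/negP => Tj; have := setD11 j A; rewrite -TA inE Tj Aj.
have nTei : edge i \notin T.2.
  by apply: contra nTj => /(vertex_in_edge connT)/andP[_]; rewrite -Dj.
have nTej : edge j \notin T.2.
  by apply: contra nTj => /(vertex_in_edge connT)/andP[]; rewrite vtx_ord.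
have Ti : i \in T.1 by apply: (subsetP sBT); rewrite !inE neq_ij.
have Tl : l \in T.1 by apply: (subsetP sBT); rewrite !inE neq_lj.
(* A third missing edge would, together with [edge j], separate [i] from [l]; so [T] has at least
   [n - 2] edges. *)
have cardT : n <= #|[set i; j]| + #|T.2|.
  apply: leq_card_edges => x; rewrite !inE negb_or => /andP[neq_xi neq_xj].
  have {}neq_xi : x <> i :> nat by move/val_inj/eqP; apply/negP.
  have {}neq_xj : x <> j :> nat by move/val_inj/eqP; apply/negP.
  have ltxn := ltn_ord x.
  apply/negPn/negP => nTx; have [ltxj|ltjx|//] := ltngtP x j.
    have := missing_edges connT ltxj nTx nTej Ti Tl.
    by clear -ltxj neq_xi Ej El ltin ltxn; lia.
  have := missing_edges connT ltjx nTej nTx Ti Tl.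
  by clear -ltjx neq_xi Ej El ltin ltxn; lia.
have sA' : A \subset (arc c.+1 m.+1).1.
  by apply/subsetP => x Ax; apply: mem_arcC1; apply: contraNneq nAc => <-.
(* Cutting out [c] instead is no more expensive, but this tree passes through [j]. *)
have sT' : steiner_tree (A :\ j) (arc c.+1 m.+1).
  apply/steiner_treeP; split=> [|H' /minT].
    by rewrite /connects connected_arc (subset_trans (subD1set _ _)).
  apply: leq_trans; apply: leq_trans (card_arc_edges _ _) _.
  by move: cardT; rewrite cards2 neq_ij.
have := setD11 j A; rewrite -(sgp_setE sA (subD1set A j) cardB sT').
by rewrite (setIidPr sA') Aj.
Qed.

(** * Evenly spread sets of [p] vertices *)

Section Balanced.

Variable p : nat.
Hypotheses (p_gt2 : 2 < p) (le_pn : p <= n) (sparse : p = n \/ 3 * p <= 2 * n).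

(** Positions are not reduced modulo [n]: an index [t >= p] continues around the cycle. *)
Definition pos t := t * n %/ p.

Definition balanced_set : {set Cn} := [set vtx (pos t) | t : 'I_p].

Let p_gt0 : 0 < p. Proof. exact: ltnW (ltnW p_gt2). Qed.

Lemma pos0 : pos 0 = 0.
Proof. exact: div0n. Qed.

Lemma posDp t : pos (t + p) = pos t + n.
Proof. by rewrite /pos mulnDl [p * n]mulnC addnC divnMDl // addnC. Qed.

Lemma pos_leq : {homo pos : s t / s <= t}.
Proof. by move=> s t le_st; rewrite leq_div2r // leq_mul2r le_st orbT. Qed.

Lemma pos_ltnS t : pos t < pos t.+1.
Proof.
rewrite /pos leq_divRL // !mulSnr.
exact: leq_add (leq_divM _ _) le_pn.
Qed.

Lemma ltn_pos t : (pos t < n) = (t < p).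
Proof. by rewrite ltn_divLR // [n * p]mulnC ltn_pmul2r. Qed.

(** Rounding down makes two consecutive gaps together longer than [2n/p - 1] and a single gap
    shorter than [n/p + 1]. *)
Lemma pos_gap s t : pos s + pos t.+1 < pos s.+2 + pos t.
Proof.
rewrite ltnNge; apply/negP => le_gap.
have bounds u : pos u * p <= u * n < (pos u).+1 * p.
  by rewrite leq_divM -ltn_divLR // leqnn.
have [/andP[Bs _] /andP[_ Bs2]] := (bounds s, bounds s.+2).
have [/andP[_ Bt] /andP[Bt1 _]] := (bounds t, bounds t.+1).
have [e Ee] : exists e, pos s.+2 = pos s + e.
  by exists (pos s.+2 - pos s); rewrite subnKC // pos_leq // leqW.
have [d Ed] : exists d, pos t.+1 = pos t + d.
  by exists (pos t.+1 - pos t); rewrite subnKC // pos_leq.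
have le_ed : e <= d by lia.
have long2 : 2 * n < e.+1 * p.
  by move: Bs Bs2; rewrite Ee !mulSn mulnDl; lia.
have short1 : d * p < n + p.
  by move: Bt Bt1; rewrite Ed !mulSn mulnDl; lia.
have {long2} : 2 * n < d.+1 * p by rewrite (leq_trans long2) // leq_mul2r ltnS le_ed orbT.
(* [d <= 1] contradicts [p <= n], [d = 2] contradicts [sparse], and for [d >= 3] the two bounds
   contradict each other. *)
by case: d short1 {Ed le_gap le_ed Bt1} => [|[|[|d]]]; rewrite ?mulSn; lia.
Qed.

(** A tree [T] through the omitted point [a] contains the whole set, so all its missing edges lie in
    one gap. The arc avoiding [a] saves the two gaps next to [a], which is more by [pos_gap]. *)
Lemma balanced_sgp_set : sgp_set p.-1 balanced_set.
Proof.
have mem_pos t : t < p -> vtx (pos t) \in balanced_set.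
  by move=> lt; apply/imsetP; exists (Ordinal lt).
apply/forallP => B; apply/implyP => /andP[sBA /eqP cardB].
apply/forallP => T; apply/implyP => sT; rewrite eqEsubset subsetI sBA andbT.
have /steiner_treeP[/andP[connT sBT] minT] := sT; rewrite sBT andbT.
apply/subsetP => a /setIP[Ta Aa]; apply/negPn/negP => nBa.
have cardA : #|balanced_set| <= p by rewrite (leq_trans (leq_imset_card _ _)) ?card_ord.
have EB : B = balanced_set :\ a.
  apply/eqP; rewrite eqEcard subsetD1 sBA nBa /= cardB.
  by rewrite -ltnS -card_setD1 // prednK.
have sAT : balanced_set \subset T.1.
  by apply/subsetP => x Ax; have [->//|neq] := eqVneq x a; apply: (subsetP sBT); rewrite EB !inE neq.
have Tpos t : t < p -> vtx (pos t) \in T.1 by move=> lt; apply/(subsetP sAT)/mem_pos.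
have val_pos t : t < p -> vtx (pos t) = pos t :> nat.
  by move=> lt; rewrite /= modn_small // ltn_pos.
(* Edges missing from two different gaps would separate points of the set. *)
have [g cardM] : exists g, n <= pos g.+1 - pos g + #|T.2|.
  pose M : {set Cn} := [set x : Cn | edge x \notin T.2].
  have leM : n <= #|M| + #|T.2|.
    by apply: leq_card_edges => x; rewrite inE negbK.
  suff [g leg] : exists g, #|M| <= pos g.+1 - pos g.
    by exists g; rewrite (leq_trans leM) // leq_add2r.
  have [->|[x0 Mx0]] := set_0Vmem M; first by exists 0; rewrite cards0.
  (* The gap containing [x0] starts at the last point not beyond [x0]. *)
  have ex_g : exists g, (g < p) && (pos g <= x0) by exists 0; rewrite p_gt0 pos0.
  have ub_g g : (g < p) && (pos g <= x0) -> g <= p by case/andP => /ltnW.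
  case: (ex_maxnP ex_g ub_g) => g /andP[ltgp le_gx0] maxg; exists g.
  have lt_x0g : x0 < pos g.+1.
    rewrite ltnNge; apply/negP => le_gSx0; have := maxg g.+1.
    by rewrite le_gSx0 ltnn -ltn_pos (leq_ltn_trans le_gSx0) // => /(_ isT).
  apply: leq_trans (card_ord_interval n (pos g) (pos g.+1)).
  apply/subset_leq_card/subsetP => x Mx; rewrite inE.
  move: Mx Mx0; rewrite !inE => nTx nTx0; apply/negPn/negP.
  have T0 := Tpos 0 p_gt0; have v0 := val_pos 0 p_gt0.
  rewrite negb_and -ltnNge -leqNgt => /orP[ltxg|legx].
    have := missing_edges connT (leq_trans ltxg le_gx0) nTx nTx0 (Tpos g ltgp) T0.
    by rewrite (val_pos g ltgp) v0 pos0 ltxg le_gx0.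
  have ltgSp : g.+1 < p by rewrite -ltn_pos (leq_ltn_trans legx).
  have := missing_edges connT (leq_trans lt_x0g legx) nTx0 nTx (Tpos g.+1 ltgSp) T0.
  by rewrite (val_pos _ ltgSp) v0 pos0 lt_x0g legx.
have /imsetP[t _ Ea] := Aa.
(* The arc runs from the successor of [a] once around to its predecessor, whose index is
   [t - 1 + p]. *)
pose l := pos (t + p.-1) - pos t.+1.
have le_t : t.+1 <= t + p.-1 by clear -p_gt2; lia.
have sB : B \subset (arc (pos t.+1) l).1.
  apply/subsetP => x; rewrite EB => /setD1P[neq_xa /imsetP[u _ Ex]].
  have neq_ut : u <> t :> nat by move/val_inj => E; rewrite Ex Ea E eqxx in neq_xa.
  have in_arc v : t < v <= t + p.-1 -> vtx (pos v) \in (arc (pos t.+1) l).1.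
    case/andP=> ltv lev; rewrite -(subnKC (pos_leq ltv)).
    by apply: mem_arc; rewrite leq_sub2r // pos_leq.
  have [ltup lttp] := (ltn_ord u, ltn_ord t).
  rewrite {}Ex; have [ltut|letu] := ltnP u t; last first.
    by apply: in_arc; clear -neq_ut letu ltup lttp; lia.
  have -> : vtx (pos u) = vtx (pos (u + p)) by apply/val_inj; rewrite posDp /= modnDr.
  by apply: in_arc; clear -ltut lttp ltup; lia.
have leT : #|T.2| <= l.
  by apply: leq_trans (card_arc_edges (pos t.+1) l); apply: minT; rewrite /connects connected_arc.
(* The two gaps around [a] have total length [n - l], so gap [g] is shorter and [T] has more than
   [l] edges. *)
have := pos_gap (t + p.-1) g.
have -> : (t + p.-1).+2 = t.+1 + p by clear -p_gt2; lia.
rewrite posDp; have := pos_leq le_t; move: cardM leT (pos_leq (leqnSn g)).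
by rewrite /l; clear; lia.
Qed.

Lemma card_balanced_set : #|balanced_set| = p.
Proof.
have pos_mono : {homo pos : s t / s < t} by apply: homo_ltn => [t|]; [apply: ltn_trans | apply: pos_ltnS].
rewrite card_imset ?card_ord // => s t /(congr1 (fun x : Cn => nat_of_ord x)).
rewrite /= !modn_small ?ltn_pos // => E; apply/val_inj.
by have [/pos_mono|/pos_mono|//] := ltngtP (val s) (val t); rewrite E ltnn.
Qed.

End Balanced.

End CycleSteiner.

(** * The value in the two ranges of [k] *)

Theorem theorem3p2 (n k : nat) (hn : 3 <= n) (hk : 2 <= k <= n - 1) :
  sgp (cycle_graph n) k =
    if (2 * n) %/ 3 <= k <= n - 2 then k else k + 1.
Proof.
case: n hn hk => [|[|[|m]]] // _; set n := m.+3 => /andP[k_gt1 lekn].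
case: ifP => [/andP[le_k lek2]|range].
  apply/eqP; rewrite eqn_leq; apply/andP; split.
    apply/bigmax_leqP => A sA; apply: card_sgp_set_dense sA => //; lia.
  have [|S _ cardS] := @subset_of_card (cycle_graph n) setT k.
    by rewrite cardsT card_cycle; lia.
  exact: leq_trans (eq_leq (esym cardS)) (leq_sgp (sgp_set_card cardS)).
rewrite addn1; apply/eqP; rewrite eqn_leq; apply/andP; split.
  by apply/bigmax_leqP => A; apply: card_sgp_set_le.
have k1n : k.+1 <= n by lia.
(* Outside the range, either [k = n - 1] or [k + 1] is at most the floor of [2n/3]. *)
have sparse : k.+1 = n \/ 3 * k.+1 <= 2 * n.
  move/negbT: range; rewrite negb_and -!ltnNge => /orP[|]; last by left; lia.
  by rewrite leq_divRL // mulnC; right.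
have := leq_sgp (@balanced_sgp_set m k.+1 k_gt1 k1n sparse).
by rewrite card_balanced_set.
Qed.
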